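(* A Boolean function $f:\mathbb{F}_2^n\to\mathbb{F}_2$ is a bent function of weight $2^{n-1}-2^{n/2-1}$ if and only if it is a perfect $2$-coloring (with colors $0$ and $1$) of the subspace hypergraph $\mathcal{H}_n$ with the parameter matrix $S$ such that $$\begin{array}{ll} s_{0,0,0}=2^{n-3}+2^{n/2-2}-1; & s_{1,0,0}=2^{n-3}+2^{n/2-2};\\ s_{0,0,1}=s_{0,1,0}=2^{n-3}; & s_{1,1,0}=s_{1,0,1}=2^{n-3}-1/2;\\ s_{0,1,1}=2^{n-3}-2^{n/2-2}; & s_{1,1,1}=2^{n-3}-2^{n/2-2}. \end{array}$$
   Context: $\overline 0$ is the zero vector of $\mathbb{F}_2^n$. For a Boolean function $f$, the Fourier transform is $\widehat f(x)=\frac{1}{2^{n/2}}\sum_{z\in\mathbb{F}_2^n}(-1)^{f(z)+(x,z)}$ with $(x,z)=x_1z_1+\dots+x_nz_n$; $f$ is bent if $\widehat f(x)=\pm1$ for all $x$. The weight of $f$ is $|\{x:f(x)=1\}|$. The subspace hypergraph $\mathcal{H}_n$ is the $3$-uniform hypergraph with vertex set $\mathbb{F}_2^n\setminus\{\overline 0\}$ whose hyperedges are the $3$-element sets $\{x,y,z\}$ of vertices with $x+y+z=\overline 0$. Since $\overline 0$ is not a vertex, the coloring of $\mathcal{H}_n$ given by $f$ is the one assigning to each vertex $x\ne\overline 0$ the color $f(x)$. A coloring of a hypergraph is a surjective function $f$ from the vertex set onto the set of colors. The color range of a hyperedge $e$ is the multiset $\{f(x):x\in e\}$. The coloring is perfect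 if any two vertices of the same color have the same multiset of color ranges of incident hyperedges; equivalently, for every color $i_1$ and color range $\{i_1,i_2,i_3\}$, the number $v_{i_1,\{i_1,i_2,i_3\}}$ of hyperedges with this color range incident to a vertex $x$ of color $i_1$ does not depend on the choice of $x$. The parameter matrix of a perfect coloring of a $3$-uniform hypergraph is $S=(s_{i_1,i_2,i_3})$ (indices ranging over colors) with $s_{i,j,j}=v_{i,\{i,j,j\}}$ and $s_{i,j,\ell}=\frac12 v_{i,\{i,j,\ell\}}$ for $j\ne\ell$.
   Formalization: The formal theorem assumes f(0)=0 and n≥1; without f(0)=0 the claim fails, e.g. for n=2 the indicator of the zero vector is bent of weight 1, but it gives all vertices color 0 and so is not a 2-coloring. *)

(* Defs.v *)
From mathcomp Require Import all_boot all_order all_algebra.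
From mathcomp Require Import finmap multiset.
From mathcomp Require Import reals exp.

Set Implicit Arguments.
Unset Strict Implicit.
Unset Printing Implicit Defensive.

Import Order.TTheory GRing.Theory Num.Theory.
Local Open Scope ring_scope.
Local Open Scope mset_scope.

Section BooleanFunctions.
Variable n : nat.
Implicit Types (f : 'rV['F_2]_n -> 'F_2) (x z : 'rV['F_2]_n).

Definition dotp x z : 'F_2 := \sum_(i < n) x 0 i * z 0 i.

(* The exponent f z + (x, z) is computed in F_2 and read as 0 or 1. *)
Definition fourier (R : realType) f x : R :=
  1 / 2 `^ (n%:R / 2) *
  \sum_(z : 'rV['F_2]_n) (-1) ^+ nat_of_ord (f z + dotp x z).

Definition bent (R : realType) f : Prop :=
  forall x, fourier R f x = 1 \/ fourier R f x = -1.

Definition weight f : nat := #|[set x | f x == 1]|.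

End BooleanFunctions.

Record hypergraph3 := Hypergraph3 {
  vertex : finType;
  hyperedges : {set {set vertex}};
  hyperedges_uniform : forall e, e \in hyperedges -> #|e| = 3%N }.

Section Colorings.
Variables (H : hypergraph3) (C : choiceType).
Implicit Types (g : vertex H -> C) (x y : vertex H) (e : {set vertex H}).

Definition coloring g : Prop := forall c, exists x, g x = c.

Definition color_range g e : {mset C} := seq_mset [seq g x | x <- enum e].

Definition incident_edges x : {set {set vertex H}} :=
  [set e in hyperedges H | x \in e].

Definition incident_ranges g x : {mset {mset C}} :=
  seq_mset [seq color_range g e | e <- enum (incident_edges x)].

Definition perfect_coloring g : Prop :=
  coloring g /\
  forall x y, g x = g y -> incident_ranges g x = incident_ranges g y.

Definition range_count g x (r : {mset C}) : nat :=
  #|[set e in incident_edges x | color_range g e == r]|.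

(* For a perfect coloring [range_count g x r] only depends on the color of x,
   and every color is used, so this relation determines S uniquely. *)
Definition parameter_matrix (R : realType) g (S : C -> C -> C -> R) : Prop :=
  forall x (i j l : C), g x = i ->
    S i j l = let v := (range_count g x (seq_mset [:: i; j; l]))%:R in
              if j == l then v else 1 / 2 * v.

End Colorings.

Section SubspaceHypergraph.
Variable n : nat.

Definition nzvec : finType := {x : 'rV['F_2]_n | x != 0}.

Definition zero_sum_triples : {set {set nzvec}} :=
  [set e : {set nzvec} | (#|e| == 3%N) && (\sum_(x in e) val x == 0)].

Lemma zero_sum_triples_uniform e : e \in zero_sum_triples -> #|e| = 3%N.
Proof. by rewrite inE => /andP[/eqP]. Qed.

Definition subspace_hypergraph : hypergraph3 :=
  Hypergraph3 zero_sum_triples_uniform.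

Definition boolean_coloring (f : 'rV['F_2]_n -> 'F_2) :
    vertex subspace_hypergraph -> 'F_2 :=
  fun x : nzvec => f (val x).

End SubspaceHypergraph.

(* Main.v *)
Require Import Defs.
From mathcomp Require Import all_boot all_order all_algebra.
From mathcomp Require Import finmap multiset.
From mathcomp Require Import reals exp ring lra.

(** Everything goes through the autocorrelation
    [a x = \sum_y (-1)^(f y + f (x + y))].

    On the Fourier side, the square of the spectrum is the character transform
    of [a], so by orthogonality of characters the spectrum has constant
    absolute value exactly when [a] vanishes off the origin ([bentP]).

    On the hypergraph side, an edge through [x] is [{x, y, x + y}] for exactly
    two vertices [y], so counting the edges through [x] with given colors
    amounts to counting the vectors [y] with a given unordered pair of values
    [f y], [f (x + y)], up to the two degenerate choices [y = 0] and [y = x]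
    ([range_count_double], [pair_count_range]). The three possible pairs
    [{0,0}], [{0,1}], [{1,1}] have counts subject to three linear relations
    involving [2^n], the weight of [f] and [a x]. These relations can be solved,
    so the numbers of edges of each color range through [x] are affine
    functions of the weight and of [a x] ([range_countsE],
    [parameter_matrixE]).

    The prescribed matrix is what these functions give for [a x = 0] and weight
    [2^(n-1) - 2^(n/2-1)], and conversely the entries in the row of the color
    of a single nonzero [x] determine [a x] and the weight. Perfectness then
    comes for free, since every color range met at [x] is [{f x, j, l}] for some
    [j], [l] and is therefore counted by the matrix
    ([parameter_matrix_perfect]). *)

Set Implicit Arguments.
Unset Strict Implicit.
Unset Printing Implicit Defensive.

Import Order.TTheory GRing.Theory Num.Theory.
Local Open Scope ring_scope.

(** * Autocorrelation and the Fourier spectrum *)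

Lemma F2P (a : 'F_2) : a = 0 \/ a = 1.
Proof. by case: a => [[|[|k]] lek] //; [left|right]; apply: val_inj. Qed.

Lemma addrr_F2 n (x : 'rV['F_2]_n) : x + x = 0.
Proof. by apply/rowP => i; rewrite !mxE; case: (F2P (x 0 i)) => ->; apply/eqP. Qed.

Lemma addKr_F2 n (x y : 'rV['F_2]_n) : x + (x + y) = y.
Proof. by rewrite addrA addrr_F2 add0r. Qed.

Lemma addr_eq0_F2 n (x y : 'rV['F_2]_n) : (x + y == 0) = (x == y).
Proof. by rewrite -(inj_eq (addrI x)) addKr_F2 addr0 eq_sym. Qed.

Section Autocorrelation.
Variable n : nat.
Implicit Types (u x y z : 'rV['F_2]_n).

Lemma dotpDl x y z : dotp (x + y) z = dotp x z + dotp y z.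
Proof. by rewrite -big_split; apply: eq_bigr => i _; rewrite mxE mulrDl. Qed.

Lemma dotpDr x y z : dotp x (y + z) = dotp x y + dotp x z.
Proof. by rewrite -big_split; apply: eq_bigr => i _; rewrite mxE mulrDr. Qed.

Lemma dotp_delta (i : 'I_n) x : dotp (delta_mx 0 i) x = x 0 i.
Proof.
rewrite /dotp (bigD1 i) //= big1 => [|j /negbTE jNi]; rewrite !mxE ?eqxx.
  by rewrite mul1r addr0.
by rewrite jNi andbF mul0r.
Qed.

Variable R : numDomainType.

Definition sgnF2 (a : 'F_2) : R := (-1) ^+ nat_of_ord a.

Lemma sgnF2D a b : sgnF2 (a + b) = sgnF2 a * sgnF2 b.
Proof.
by case: (F2P a) => ->; case: (F2P b) => ->;
  rewrite /sgnF2 /= ?expr0 ?expr1 ?mulr1 ?mul1r ?mulrNN ?mulr1.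
Qed.

Lemma sgnF2_sqr a : sgnF2 a * sgnF2 a = 1.
Proof. by rewrite -sgnF2D; case: (F2P a) => ->. Qed.

(** Orthogonality of characters: translating by a basis vector on which the
    character takes the value -1 negates the sum. *)
Lemma sum_sgnF2_dotp x :
  \sum_u sgnF2 (dotp u x) = if x == 0 then 2 ^+ n else 0.
Proof.
case: eqVneq => [->|/rV0Pn[i xi_neq0]].
  transitivity (\sum_(u : 'rV['F_2]_n) (1 : R)).
    by apply: eq_bigr => u _; rewrite /dotp big1 // => j _; rewrite mxE mulr0.
  by rewrite sumr_const card_mx card_Fp // mul1n natrX.
set s := \sum_u _.
have: s = - s.
  rewrite {1}/s (reindex_inj (addrI (delta_mx 0 i))) /= -sumrN.
  apply: eq_bigr => u _; rewrite dotpDl dotp_delta sgnF2D.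
  case: (F2P (x 0 i)) xi_neq0 => -> //= _.
  by rewrite {1}/sgnF2 expr1 mulN1r.
by move/esym/eqP; rewrite eqNr => /eqP.
Qed.

Variable f : 'rV['F_2]_n -> 'F_2.

Definition walsh u : R := \sum_z sgnF2 (f z + dotp u z).

Definition autocorr x : R := \sum_y sgnF2 (f y) * sgnF2 (f (x + y)).

Lemma autocorr0 : autocorr 0 = 2 ^+ n.
Proof.
transitivity (\sum_(u : 'rV['F_2]_n) (1 : R)).
  by apply: eq_bigr => y _; rewrite add0r sgnF2_sqr.
by rewrite sumr_const card_mx card_Fp // mul1n natrX.
Qed.

(** Wiener-Khinchin: the square of the spectrum is the transform of the
    autocorrelation. *)
Lemma walsh_sqr u : walsh u ^+ 2 = \sum_x sgnF2 (dotp u x) * autocorr x.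
Proof.
rewrite expr2 big_distrlr /=.
under [RHS]eq_bigr do rewrite big_distrr /=.
rewrite [RHS]exchange_big /=; apply: eq_bigr => y _.
rewrite (reindex_inj (addIr y)); apply: eq_bigr => x _.
rewrite !sgnF2D dotpDr sgnF2D.
rewrite -[RHS]mulr1 -(sgnF2_sqr (dotp u y)); ring.
Qed.

(** The inverse transform of [walsh_sqr]. *)
Lemma sum_walsh_sqr x :
  \sum_u sgnF2 (dotp u x) * walsh u ^+ 2 = 2 ^+ n * autocorr x.
Proof.
under eq_bigr do rewrite walsh_sqr big_distrr /=.
rewrite exchange_big /= (bigD1 x) //= [X in _ + X]big1 => [|y yNx].
  rewrite addr0; under eq_bigr do rewrite mulrA sgnF2_sqr mul1r.
  by rewrite sumr_const card_mx card_Fp // mul1n -natrX mulr_natl.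
under eq_bigr do rewrite mulrA -sgnF2D -dotpDr.
by rewrite -big_distrl /= sum_sgnF2_dotp addr_eq0_F2 eq_sym (negbTE yNx) mul0r.
Qed.

(** A function is constant if and only if its transform is concentrated at the
    origin; here the function is the squared spectrum. The constant is the
    autocorrelation at 0, that is, the number of vectors. *)
Lemma flat_spectrumP :
  (forall u, walsh u ^+ 2 = 2 ^+ n) <-> (forall x, x != 0 -> autocorr x = 0).
Proof.
split=> [flat x xN0 | perfect u].
  have: 2 ^+ n * autocorr x = 0.
    rewrite -sum_walsh_sqr; under eq_bigr do rewrite flat.
    by rewrite -big_distrl /= sum_sgnF2_dotp (negbTE xN0) mul0r.
  by move/eqP; rewrite mulf_eq0 expf_eq0 pnatr_eq0 andbF /= => /eqP.
rewrite walsh_sqr (bigD1 0) //= [X in _ + X]big1 => [|x xN0].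
  by rewrite autocorr0 /dotp big1 ?mul1r ?addr0 // => i _; rewrite mxE mulr0.
by rewrite perfect ?mulr0.
Qed.

End Autocorrelation.

Lemma powR_half_sqr (R : realType) n : (2 `^ (n%:R / 2) : R) ^+ 2 = 2 ^+ n.
Proof.
rewrite -(powR_mulrn 2 (powR_ge0 _ _)) -powRrM -(powR_mulrn n) //.
by rewrite mulfVK ?pnatr_eq0.
Qed.

Lemma bentP (R : realType) n (f : 'rV['F_2]_n -> 'F_2) :
  bent R f <-> (forall x, x != 0 -> autocorr R f x = 0).
Proof.
rewrite -flat_spectrumP.
have q_gt0 : 0 < 2 `^ (n%:R / 2) :> R by rewrite powR_gt0.
have fourierE u : fourier R f u = walsh R f u / 2 `^ (n%:R / 2).
  by rewrite /fourier mul1r mulrC.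
split=> H u.
  have -> : walsh R f u = fourier R f u * 2 `^ (n%:R / 2).
    by rewrite fourierE divfK ?gt_eqF.
  by rewrite -powR_half_sqr; case: (H u) => ->; rewrite ?mulN1r ?mul1r ?sqrrN.
have /eqP := H u; rewrite -powR_half_sqr eqf_sqr fourierE.
by case/orP=> /eqP->; [left|right]; rewrite ?mulNr divff ?gt_eqF.
Qed.

(** * Color ranges in 3-uniform hypergraphs *)

Section Hypergraphs.
Variables (H : hypergraph3) (C : choiceType) (g : vertex H -> C).
Implicit Types (x y : vertex H) (e : {set vertex H}).

Lemma color_range_perm s e : perm_eq (enum e) s ->
  color_range g e = seq_mset (map g s).
Proof. by move=> es; apply/eq_seq_msetP; rewrite perm_map. Qed.

Lemma incident_rangeP x e : e \in incident_edges x ->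
  exists j l, color_range g e = seq_mset [:: g x; j; l].
Proof.
rewrite inE => /andP[/hyperedges_uniform e3 xe].
have perm_e : perm_eq (enum e) (x :: enum (e :\ x)).
  apply: uniq_perm; rewrite /= ?enum_uniq // ?mem_enum ?setD11 //.
  by move=> y; rewrite inE !mem_enum !inE; case: eqVneq => // ->.
move: (cardsD1 x e); rewrite e3 xe => -[/esym]; rewrite cardE.
rewrite (color_range_perm perm_e).
by case: (enum _) => [|y [|z []]] // _; exists (g y), (g z).
Qed.

Lemma incident_rangesE x r : incident_ranges g x r = range_count g x r.
Proof.
rewrite /incident_ranges mset_seqE count_map /range_count -size_filter.
rewrite cardE /enum_mem -filter_predI; congr size.
by apply: eq_filter => e; rewrite !inE /= andbC.
Qed.

(** A color range occurring at a vertex of color [i] has the form [{i, j, l}], so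
    its multiplicity is read off from the matrix, which only knows [i]. Color
    ranges that occur at neither vertex have multiplicity 0 at both. *)
Lemma parameter_matrix_perfect (R : realType) (S : C -> C -> C -> R) :
  parameter_matrix g S ->
  forall x y, g x = g y -> incident_ranges g x = incident_ranges g y.
Proof.
move=> gS.
(* By symmetry it is enough to treat the ranges that do occur at [x]. *)
suff count_eq x y r : g x = g y ->
    (0 < range_count g x r)%N -> range_count g x r = range_count g y r.
  move=> x y gxy; apply/msetP => r; rewrite !incident_rangesE.
  have [x0|/(count_eq x y r gxy)//] := posnP (range_count g x r).
  by have [->|/(count_eq y x r (esym gxy))] := posnP (range_count g y r).
move=> gxy; rewrite card_gt0 => /set0Pn[e]; rewrite inE => /andP[ex /eqP er].
have [j [l]] := incident_rangeP ex; rewrite er => {er}->.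
have := gS y _ j l erefl; rewrite -gxy (gS x _ j l erefl) /=.
have half_neq0 : 1 / 2 != 0 :> R by rewrite mul1r invr_eq0 pnatr_eq0.
by case: ifP => _ => [|/(mulfI half_neq0)] /eqP; rewrite eqr_nat => /eqP.
Qed.

End Hypergraphs.

(** * Edges of the subspace hypergraph *)

Section SubspaceEdges.
Variables (n : nat) (C : choiceType).
Notation H := (subspace_hypergraph n).
Implicit Types (x y : vertex H) (e : {set vertex H}).

(** The default value [x] is only taken when [y = x], where [x + y] is not a
    vertex. *)
Definition third x y : vertex H := insubd (x : nzvec n) (val x + val y).

Lemma val_third x y : y != x -> val (third x y) = val x + val y.
Proof. by move=> yNx; rewrite val_insubd addr_eq0_F2 (inj_eq val_inj) eq_sym yNx. Qed.

Definition edge x y : {set vertex H} := [set x; y; third x y].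

Lemma third_neql x y : y != x -> third x y != x.
Proof.
move=> yNx; apply/eqP => /(congr1 val); rewrite val_third //.
by move/eqP; rewrite -subr_eq0 addrAC subrr add0r (negbTE (valP y)).
Qed.

Lemma third_neqr x y : y != x -> third x y != y.
Proof.
move=> yNx; apply/eqP => /(congr1 val); rewrite val_third //.
by move/eqP; rewrite -subr_eq0 addrK (negbTE (valP x)).
Qed.

Lemma enum_edge x y : y != x -> perm_eq (enum (edge x y)) [:: x; y; third x y].
Proof.
move=> yNx; apply: uniq_perm; rewrite ?enum_uniq //.
  rewrite /= !inE negb_or eq_sym yNx eq_sym third_neql //.
  by rewrite eq_sym third_neqr.
by move=> z; rewrite mem_enum !inE orbA.
Qed.

Lemma edge_incident x y : y != x -> edge x y \in incident_edges x.
Proof.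
move=> yNx; have pe := enum_edge yNx.
rewrite !inE eqxx /= andbT cardE (perm_size pe) eqxx /=.
rewrite -big_enum (perm_big _ pe) /= !big_cons big_nil addr0 /=.
by rewrite val_third // addrA addrr_F2.
Qed.

Lemma incident_edgeE x y e :
  e \in incident_edges x -> y \in e -> y != x -> e = edge x y.
Proof.
rewrite !inE => /andP[/andP[/eqP e3 /eqP sum_e] xe] ye yNx.
have yex : y \in e :\ x by rewrite !inE yNx.
have /cards1P[z ez] : #|(e :\ x) :\ y| == 1%N.
  by move: e3; rewrite (cardsD1 x e) xe (cardsD1 y (e :\ x)) yex !add1n => -[->].
have sum3 : val x + (val y + val z) = 0.
  by move: sum_e; rewrite (big_setD1 x xe) (big_setD1 y yex) /= ez big_set1.
have zE : third x y = z.
  apply: val_inj; rewrite val_third //.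
  by apply: (addrI (val x + val y)); rewrite addrr_F2 -addrA sum3.
apply/setP => t; rewrite !inE zE.
move/setP/(_ t): ez; rewrite !inE => <-.
have [->|_ /=] := eqVneq t y; first by rewrite ye orbT.
by have [->|] := eqVneq t x; first by rewrite xe.
Qed.

Variable g : vertex H -> C.

(** Double counting: each edge through [x] equals [edge x y] exactly for its two
    vertices [y] other than [x]. *)
Lemma range_count_double x r :
  (range_count g x r).*2 =
  #|[set y | (y != x) && (seq_mset [:: g x; g y; g (third x y)] == r)]|.
Proof.
have edge_range y : y != x ->
    color_range g (edge x y) = seq_mset [:: g x; g y; g (third x y)].
  by move=> yNx; rewrite (color_range_perm _ (enum_edge yNx)).
rewrite -[RHS]sum1_card (partition_big (edge x)
  (mem [set e in incident_edges x | color_range g e == r])) /=; last first.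
  by move=> y; rewrite inE => /andP[yNx yr]; rewrite inE edge_incident // edge_range.
rewrite -muln2 -sum_nat_const; apply: eq_bigr => e.
rewrite inE => /andP[ex /eqP er].
have := ex; rewrite !inE => /andP[/andP[/eqP e3 _] xe].
transitivity #|e :\ x|.
  by move: e3; rewrite (cardsD1 x e) xe add1n => -[->].
rewrite -sum1_card; apply: eq_bigl => y; rewrite !inE.
case: eqVneq => //= yNx; rewrite -edge_range //.
apply/idP/andP => [ye|[_ /eqP<-]]; last by rewrite !inE eqxx orbT.
by rewrite -(incident_edgeE ex ye yNx) er.
Qed.

End SubspaceEdges.

(** * Counting pairs of values *)

Section PairCounts.
Variables (n : nat) (f : 'rV['F_2]_n -> 'F_2).
Implicit Types x y : 'rV['F_2]_n.

(** Comparison by [perm_eq] makes the pair of values unordered. *)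
Definition pair_count x (j l : 'F_2) : nat :=
  #|[set y | perm_eq [:: f y; f (x + y)] [:: j; l]]|.

(** The vectors [y = 0] and [y = x] span no edge with [x]; both produce the pair
    [{f 0, f x}], which explains the correction term. *)
Lemma pair_count_range (x : vertex (subspace_hypergraph n)) i j l :
  f 0 = 0 -> f (val x) = i ->
  pair_count (val x) j l =
  (perm_eq [:: 0; i] [:: j; l] +
   range_count (boolean_coloring f) x (seq_mset [:: i; j; l])).*2.
Proof.
move=> f0 <-; rewrite doubleD range_count_double /pair_count.
set A := [set y | perm_eq _ _].
have x_neq0 : val x != 0 := valP x.
rewrite (cardsD1 0) (cardsD1 (val x)) !inE x_neq0 addr0 addrr_F2 f0.
rewrite addnA -addnn; congr (_ + _ + _)%N.
  by rewrite -[in LHS](perm_rcons _ [:: _]).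
rewrite -[RHS](card_imset _ val_inj); apply: eq_card => y.
rewrite !inE; apply/and3P/imsetP.
  move=> [yNx y_neq0 yA]; exists (Sub y y_neq0).
    rewrite inE -(inj_eq val_inj) /= yNx; apply/eqP/eq_seq_msetP.
    by rewrite perm_cons /boolean_coloring val_third.
  by rewrite SubK.
move=> [z]; rewrite inE => /andP[zNx /eqP/eq_seq_msetP] + ->.
rewrite perm_cons /boolean_coloring val_third // => zA.
by rewrite (inj_eq val_inj) zNx (valP z).
Qed.

Variable R : realFieldType.

Lemma pair_countE x j l : (pair_count x j l)%:R =
  \sum_y (perm_eq [:: f y; f (x + y)] [:: j; l])%:R :> R.
Proof. by rewrite /pair_count -sum1dep_card big_mkcond natr_sum. Qed.

Lemma weightE : (weight f)%:R = \sum_y (f y == 1)%:R :> R.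
Proof. by rewrite /weight -sum1dep_card big_mkcond natr_sum. Qed.

Lemma sum_pair_count x :
  (pair_count x 0 0)%:R + (pair_count x 0 1)%:R + (pair_count x 1 1)%:R
  = 2 ^+ n :> R.
Proof.
transitivity (\sum_(y : 'rV['F_2]_n) (1 : R)).
  rewrite !pair_countE -!big_split; apply: eq_bigr => y _ /=.
  by case: (F2P (f y)) => ->; case: (F2P (f (x + y))) => ->;
    rewrite /= ?addr0 ?add0r.
by rewrite sumr_const card_mx card_Fp // mul1n natrX.
Qed.

(** Translation by [x] is a bijection, so the values 1 are counted once as [f y]
    and once as [f (x + y)]. *)
Lemma pair_count_weight x :
  (pair_count x 0 1)%:R + 2 * (pair_count x 1 1)%:R = 2 * (weight f)%:R :> R.
Proof.
rewrite !(mulr_natl _ 2) [RHS]mulr2n {2}weightE (reindex_inj (addrI x)) /=.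
rewrite weightE !pair_countE -sumrMnl -!big_split; apply: eq_bigr => y _ /=.
by case: (F2P (f y)) => ->; case: (F2P (f (x + y))) => ->;
  rewrite /= ?mul0rn ?addr0 ?add0r.
Qed.

Lemma autocorrE x : autocorr R f x =
  (pair_count x 0 0)%:R + (pair_count x 1 1)%:R - (pair_count x 0 1)%:R.
Proof.
rewrite !pair_countE -big_split -sumrB; apply: eq_bigr => y _ /=.
by case: (F2P (f y)) => ->; case: (F2P (f (x + y))) => ->;
  rewrite /sgnF2 /= ?expr0 ?expr1; ring.
Qed.

(** Solution of the linear system formed by [sum_pair_count],
    [pair_count_weight] and [autocorrE]. *)
Lemma range_countsE (x : vertex (subspace_hypergraph n)) i :
  f 0 = 0 -> f (val x) = i ->
  let v j l := (range_count (boolean_coloring f) x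
                 (seq_mset [:: i; j; l]))%:R : R in
  let a := autocorr R f (val x) in
  let w := (weight f)%:R : R in
  [/\ v 0 0 = 3 / 8 * 2 ^+ n - w / 2 + a / 8 - (i == 0)%:R,
      v 0 1 = 2 ^+ n / 4 - a / 4 - (i == 1)%:R,
      v 1 0 = v 0 1
    & v 1 1 = w / 2 - 2 ^+ n / 8 + a / 8].
Proof.
move=> f0 fx v a w.
have v10 : v 1 0 = v 0 1.
  have rangeC : seq_mset [:: i; 1; 0] = seq_mset [:: i; 0; 1].
    by apply/eq_seq_msetP; rewrite perm_cons.
  by rewrite /v rangeC.
have vE j l : (pair_count (val x) j l)%:R =
    2 * ((perm_eq [:: 0; i] [:: j; l])%:R + v j l).
  by rewrite (pair_count_range j l f0 fx) -mul2n natrM natrD.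
have := sum_pair_count (val x); have := pair_count_weight (val x).
have := autocorrE (val x); rewrite -/a -/w !vE.
move: (2 ^+ n) a w v v10 {vE fx} => N a w v v10.
by case: (F2P i) => -> /= aE wE sE; split; lra.
Qed.

End PairCounts.

(** The bridge from the coloring to linear equations: [range_countsE] with the
    count of the mixed range halved, as it is shared by two matrix entries. *)
Lemma parameter_matrixE (R : realType) n (f : 'rV['F_2]_n -> 'F_2)
    (S : 'F_2 -> 'F_2 -> 'F_2 -> R) : f 0 = 0 ->
  parameter_matrix (boolean_coloring f) S <->
  forall x i, x != 0 -> f x = i ->
    let a := autocorr R f x in
    let w := (weight f)%:R : R in
    [/\ S i 0 0 = 3 / 8 * 2 ^+ n - w / 2 + a / 8 - (i == 0)%:R,
        S i 0 1 = 2 ^+ n / 8 - a / 8 - (i == 1)%:R / 2,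
        S i 1 0 = S i 0 1
      & S i 1 1 = w / 2 - 2 ^+ n / 8 + a / 8].
Proof.
move=> f0; split=> [parS x i x_neq0 fx a w | SE x i j l fx].
  have [v00 v01 v10 v11] :=
    @range_countsE _ _ R (Sub x x_neq0 : nzvec n) _ f0 fx.
  have s00 := etrans (parS (Sub x x_neq0 : nzvec n) i 0 0 fx) v00.
  have s01 := etrans (parS (Sub x x_neq0 : nzvec n) i 0 1 fx)
    (congr1 ( *%R (1 / 2)) v01).
  have s10 := etrans (parS (Sub x x_neq0 : nzvec n) i 1 0 fx)
    (congr1 ( *%R (1 / 2)) (etrans v10 v01)).
  have s11 := etrans (parS (Sub x x_neq0 : nzvec n) i 1 1 fx) v11.
  rewrite s00 s10 s01 s11 -/a -/w.
  by move: (2 ^+ n) a w ((i == 0)%:R) ((i == 1)%:R); clear => N a w b c; split; lra.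
have [s00 s01 s10 s11] := SE _ _ (valP x) fx.
have [v00 v01 v10 v11] := @range_countsE _ _ R x _ f0 fx.
have v01_half := congr1 ( *%R (1 / 2)) v01.
have v10_half := congr1 ( *%R (1 / 2)) v10.
case: (F2P j) => ->; case: (F2P l) => ->.
- exact: etrans s00 (esym v00).
- apply: etrans s01 (etrans _ (esym v01_half)).
  by move: (2 ^+ n) (autocorr _ _ _) ((i == 1)%:R); clear => N a b; lra.
- apply: etrans s10 (etrans s01 (etrans _ (esym (etrans v10_half v01_half)))).
  by move: (2 ^+ n) (autocorr _ _ _) ((i == 1)%:R); clear => N a b; lra.
- exact: etrans s11 (esym v11).
Qed.

(** * The characterization *)

(** As 0 has color 0, color 1 is used as soon as the weight is positive, and some
    nonzero vector has color 0 unless all [2^n - 1] of them have color 1. *)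
Lemma boolean_coloring_surj n (f : 'rV['F_2]_n -> 'F_2) : f 0 = 0 ->
  (0 < weight f)%N -> ((weight f).+1 < 2 ^ n)%N -> coloring (boolean_coloring f).
Proof.
move=> f0 w_gt0 w_lt.
suff nonconst c : exists2 x, x != 0 & f x = c.
  by move=> c; have [x x_neq0 fx] := nonconst c; exists (Sub x x_neq0).
case: (F2P c) => ->.
  have /subsetPn[x] : ~~ ([set~ 0] \subset [set x | f x == 1]).
    apply/negP => /subset_leq_card; rewrite cardsC1 card_mx card_Fp // mul1n.
    by rewrite -ltnS prednK ?expn_gt0 // leqNgt w_lt.
  by rewrite !inE => x_neq0; have [fx _|-> //] := F2P (f x); exists x.
have /card_gt0P[x] := w_gt0; rewrite inE => /eqP fx; exists x => //.
by apply: contra_eqN fx => /eqP->; rewrite f0.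
Qed.

Theorem proposition8 (R : realType) (n : nat) (n_gt0 : (0 < n)%N)
    (f : 'rV['F_2]_n -> 'F_2) (f0 : f 0 = 0) :
  (bent R f /\
   (weight f)%:R = 2 `^ (n%:R - 1) - 2 `^ (n%:R / 2 - 1) :> R)
  <->
  (exists S : 'F_2 -> 'F_2 -> 'F_2 -> R,
     perfect_coloring (boolean_coloring f) /\
     parameter_matrix (boolean_coloring f) S /\
     S 0 0 0 = 2 `^ (n%:R - 3) + 2 `^ (n%:R / 2 - 2) - 1 /\
     S 0 0 1 = 2 `^ (n%:R - 3) /\
     S 0 1 0 = 2 `^ (n%:R - 3) /\
     S 0 1 1 = 2 `^ (n%:R - 3) - 2 `^ (n%:R / 2 - 2) /\
     S 1 0 0 = 2 `^ (n%:R - 3) + 2 `^ (n%:R / 2 - 2) /\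
     S 1 1 0 = 2 `^ (n%:R - 3) - 1 / 2 /\
     S 1 0 1 = 2 `^ (n%:R - 3) - 1 / 2 /\
     S 1 1 1 = 2 `^ (n%:R - 3) - 2 `^ (n%:R / 2 - 2)).
Proof.
have pow2B a k : 2 `^ (a - k%:R) = 2 `^ a / 2 ^+ k :> R.
  by rewrite powRB ?pnatr_eq0 ?implybT // powR_mulrn.
rewrite bentP -[2 `^ (n%:R - 1)]/(2 `^ (n%:R - 1%:R)).
rewrite -[2 `^ (n%:R / 2 - 1)]/(2 `^ (n%:R / 2 - 1%:R)).
rewrite !pow2B (powR_mulrn n) // expr1.
have q_gt0 : 0 < 2 `^ (n%:R / 2) :> R by rewrite powR_gt0.
have qN := powR_half_sqr R n.
have N_ge2 : 2 <= 2 ^+ n :> R.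
  by rewrite -(prednK n_gt0) exprS ler_peMr ?exprn_ege1 ?ler1n.
(* With [q ^ 2 = N >= 2], all that remains is linear in [N], [q], [w] and the
   autocorrelation, except that surjectivity needs [q < N]. *)
pose N : R := 2 ^+ n; pose q : R := 2 `^ (n%:R / 2); pose w : R := (weight f)%:R.
rewrite -/N -/q -/w in q_gt0 qN N_ge2 *.
split=> [[ac0 wE]|[S [_ [/(parameter_matrixE _ f0) SE tableS]]]].
  pose S (i j l : 'F_2) : R :=
    if j != l then N / 2 ^+ 3 - (i == 1)%:R / 2
    else if j == 0 then N / 2 ^+ 3 + q / 2 ^+ 2 - (i == 0)%:R
    else N / 2 ^+ 3 - q / 2 ^+ 2.
  have parS : parameter_matrix (boolean_coloring f) S.
    apply/(parameter_matrixE _ f0) => x i x_neq0 _ /=.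
    rewrite /S /= (ac0 x x_neq0) -/w wE -/N.
    by clear -N q i; split; lra.
  exists S; split; last first.
    split=> //; rewrite /S /=; clear -N q.
    by do !split; lra.
  split; last exact: parameter_matrix_perfect parS.
  apply: boolean_coloring_surj => //.
    rewrite -(ltr_nat R) -/w wE; clear -N q q_gt0 qN N_ge2; nra.
  rewrite -(ltr_nat R) natrX -natr1 -/w wE -/N.
  by clear -N q q_gt0 qN N_ge2; nra.
move: tableS => [S000 [S001 [_ [S011 [S100 [_ [S101 S111]]]]]]].
have key x : x != 0 -> autocorr R f x = 0 /\ w = N / 2 - q / 2.
  move=> x_neq0; case: (F2P (f x)) => fx;
    have /= := SE x _ x_neq0 fx; rewrite -/N -/w.
    rewrite S000 S001 S011; clear -N q w => -[s00 s01 _ s11].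
    by split; lra.
  rewrite S100 S101 S111; clear -N q w => -[s00 s01 _ s11].
  by split; lra.
split=> [x x_neq0|]; first by have [] := key x x_neq0.
have x_neq0 : const_mx 1 != 0 :> 'rV['F_2]_n.
  by apply/rV0Pn; exists (Ordinal n_gt0); rewrite mxE.
by have [] := key _ x_neq0.
Qed.
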